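(* Let $n = 2^r m$ be a positive integer with $r\ge 0$ and $m = p_1^{\zeta_1}p_2^{\zeta_2}\cdots p_j^{\zeta_j}$ the prime factorization of $m$, where $p_1,\dots,p_j$ are distinct odd primes, $\zeta_1,\dots,\zeta_j\ge 1$, and $j>1$. Let $p$ be an odd prime with $p\nmid n$, and let $\Phi = T_{4n}\times C_p$. Then for every divisor $\lambda$ of $m$, every $\varepsilon\in\{0,1\}$, and every integer $k$ with $1\le k\le r+3$, the number $N(k,\lambda,\varepsilon)$ of subgroups of $\Phi$ of order $2^{k-1}\lambda p^{\varepsilon}$ is $$N(k,\lambda,\varepsilon)=\begin{cases}1 & \text{if } k\in\{1,2\},\\[2pt] \dfrac{n}{2^{k-3}\lambda}+1 & \text{if } 3\le k\le r+2,\\[6pt] \dfrac{n}{2^{r}\lambda} & \text{if } k=r+3.\end{cases}$$ Consequently, for each $\varepsilon\in\{0,1\}$, the sum $\sum_{\lambda\mid m}N(k,\lambda,\varepsilon)$ equals $\tau(m)$ for $k\in\{1,2\}$, equals $2^{r-k+3}\sigma(m)+\tau(m)$ for $3\le k\le r+2$, and equals $\sigma(m)$ for $k=r+3$.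
   Context: $T_{4n}$ denotes the dicyclic group of order $4n$, $T_{4n}=\langle \alpha,\beta \mid \alpha^{2n}=e,\ \alpha^n=\beta^2,\ \beta\alpha\beta^{-1}=\alpha^{-1}\rangle$ (for $n=1$ this is cyclic of order 4). $C_p$ is the cyclic group of order $p$. $\tau(x)$ is the number of positive divisors of $x$ and $\sigma(x)$ is the sum of the positive divisors of $x$. *)

(* Defs.v *)
From mathcomp Require Import all_boot all_order all_fingroup all_solvable.

Set Implicit Arguments.
Unset Strict Implicit.
Unset Printing Implicit Defensive.

Local Open Scope group_scope.

(* [\isog Grp] means isomorphism with the largest finite quotient of the
   presented group, here the presented group itself since it has order 4n.
   The last relation is not written [a ^ b = a^-1] because [a ^ b] denotes
   b^-1 * a * b. *)
Definition dicyclic (gT : finGroupType) (n : nat) (T : {group gT}) : Prop :=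
  T \isog Grp (a : b : a ^+ (2 * n)%N, a ^+ n = b ^+ 2, b * a * b^-1 = a^-1).

Definition num_subgroups (gT : finGroupType) (G : {group gT}) (d : nat) : nat :=
  #|[set H in subgroups G | #|H| == d]|.

Definition tau (x : nat) : nat := size (divisors x).

Definition sigma (x : nat) : nat := (\sum_(d <- divisors x) d)%N.

(* Main.v *)
Require Import Defs.
From mathcomp Require Import all_boot all_order all_fingroup all_solvable.
From mathcomp Require Import ssralg zmodp.

(** The orders of T and C being coprime, every subgroup of T x C is the product
    of its projections, so only the subgroups of the dicyclic group T have to be
    counted.  Let A = <a>, cyclic of order 2n and of index 2.  It has one
    subgroup of each order dividing 2n.  Every x outside A inverts A and
    squares to the involution z = a^n; hence a subgroup H of order d not
    contained in A meets A in the subgroup K of order d / 2, which contains z,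
    and H = K u Kx for any x in H outside A.  So the sets H \ A partition
    T \ A into 4n / d pieces of size d / 2, provided that 4 | d | 4n. *)

(** * Orders of joins, subgroups of index 2, and subgroup counts in cyclic groups and coprime
    products *)

Section GroupLemmas.

Local Open Scope group_scope.

(** The join is the product [K * <[x]>], and [K :&: <[x]>] contains [<[x ^+ 2]>], which has index at
    most 2 in [<[x]>]. *)
Lemma card_join_sqr_leq (gT : finGroupType) (K : {group gT}) (x : gT) :
  x \in 'N(K) -> x ^+ 2 \in K -> #|K <*> <[x]>| <= (2 * #|K|)%N.
Proof.
move=> nKx Kx2; rewrite norm_joinEr ?cycle_subG //.
rewrite -(@leq_pmul2r #|K :&: <[x]>|) ?cardG_gt0 // -mul_cardG.
rewrite [(2 * _)%N]mulnC -mulnA leq_pmul2l ?cardG_gt0 // -orderE.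
have lex : #[x] <= (2 * #[x ^+ 2])%N.
  rewrite dvdn_leq ?muln_gt0 ?order_gt0 // order_dvdn.
  by rewrite expgM expg_order.
rewrite (leq_trans lex) // leq_pmul2l // orderE subset_leq_card //.
by rewrite subsetI !cycle_subG Kx2 mem_cycle.
Qed.

Lemma card_join_sqr (gT : finGroupType) (K : {group gT}) (x : gT) :
  x \in 'N(K) -> x ^+ 2 \in K -> x \notin K -> #|K <*> <[x]>| = (2 * #|K|)%N.
Proof.
move=> nKx Kx2 K'x; apply/eqP; rewrite eqn_leq card_join_sqr_leq //=.
have sK : K \subset K <*> <[x]> := joing_subl _ _.
rewrite -(Lagrange sK) mulnC leq_pmul2l ?cardG_gt0 // indexg_gt1.
by rewrite join_subG subxx cycle_subG.
Qed.

(** A subgroup of prime index 2 is normal and maximal, so [A * H] is all of [G] and the product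
    formula applies. *)
Lemma card_setI_index2 (gT : finGroupType) (G A H : {group gT}) :
  A \subset G -> #|G : A| = 2 -> H \subset G -> ~~ (H \subset A) ->
  #|H| = (2 * #|H :&: A|)%N.
Proof.
move=> sAG iAG sHG nHA; have nA := index2_normal sAG iAG.
have maxA : maximal A G by rewrite p_index_maximal ?iAG.
have /eqP := mul_cardG A H; rewrite (mulg_normal_maximal nA) //.
rewrite -(Lagrange sAG) iAG -mulnA eqn_pmul2l ?cardG_gt0 // setIC.
by move/eqP.
Qed.

Lemma num_subgroups_cyclic (gT : finGroupType) (G : {group gT}) (d : nat) :
  cyclic G -> num_subgroups G d = (d %| #|G|).
Proof.
case/cyclicP=> a defG; rewrite /num_subgroups defG.
have -> : [set H in subgroups <[a]> | #|H| == d]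
          = [set H : {group gT} | H \subset <[a]> & #|H| == d].
  by apply/setP=> H; rewrite !inE.
have [dv | ndv] := boolP (d %| _); first by rewrite cycle_sub_group ?cards1.
apply/eqP; rewrite cards_eq0; apply/eqP/setP=> H; rewrite !inE.
by apply/negP=> /andP[/cardSg dvd /eqP dH]; rewrite dH (negbTE ndv) in dvd.
Qed.

(** The map sending [(H, K)] to their product is injective, and by coprimality every subgroup of
    order [d * e] is the product of its two projections. *)
Lemma num_subgroups_setX (gT hT : finGroupType) (G : {group gT})
    (C : {group hT}) (d e : nat) :
  d %| #|G| -> e %| #|C| -> coprime #|G| #|C| ->
  num_subgroups (setX_group G C) (d * e)
    = (num_subgroups G d * num_subgroups C e)%N.
Proof.
move=> dG eC coGC; rewrite /num_subgroups.
set A := [set H in subgroups G | _]; set B := [set H in subgroups C | _].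
rewrite -cardsX -(@card_in_imset _ _
  (fun u : {group gT} * {group hT} => setX_group u.1 u.2)); last first.
  move=> [H1 H2] [K1 K2] _ _ /(congr1 (@gval _))/= eqHK.
  have eqi x y : ((x \in H1) && (y \in H2)) = ((x \in K1) && (y \in K2)).
    by rewrite -!in_setX eqHK.
  congr (_, _); apply/val_inj/setP=> x /=.
    by have := eqi x 1; rewrite !group1 !andbT.
  by have := eqi 1 x; rewrite !group1.
apply: eq_card => L; rewrite !inE; apply/andP/imsetP=> [[sL /eqP oL] | ]; last first.
  case=> [[H K]]; rewrite !inE /= => /andP[/andP[sH /eqP oH] /andP[sK /eqP oK]] ->.
  by rewrite setXS // cardsX oH oK.
pose P1 := (fst @* L)%G; pose P2 := (snd @* L)%G.
have sL12 : L \subset setX P1 P2.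
  by apply/subsetP=> [[x y] Lxy]; rewrite inE /=;
    apply/andP; split; apply/morphimP; exists (x, y).
have sP1 : P1 \subset G.
  apply/subsetP=> _ /morphimP[[x y] _ /(subsetP sL) Gxy ->].
  by move: Gxy; rewrite inE => /andP[].
have sP2 : P2 \subset C.
  apply/subsetP=> _ /morphimP[[x y] _ /(subsetP sL) Gxy ->].
  by move: Gxy; rewrite inE => /andP[].
(* The order of a projection divides [d * e]; since [#|P1|] is coprime to [e], only the factor [d]
   remains. *)
have d1 : #|P1| %| d.
  rewrite -(@Gauss_dvdl _ _ e) -?oL ?dvdn_morphim //.
  exact: coprime_dvdl (cardSg sP1) (coprime_dvdr eC coGC).
have d2 : #|P2| %| e.
  rewrite -(@Gauss_dvdr _ d) -?oL ?dvdn_morphim //.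
  rewrite coprime_sym; exact: coprime_dvdl dG (coprime_dvdr (cardSg sP2) coGC).
have d_gt0 : 0 < d := dvdn_gt0 (cardG_gt0 G) dG.
have e_gt0 : 0 < e := dvdn_gt0 (cardG_gt0 C) eC.
(* The bound [d * e <= #|P1| * #|P2|], with each factor at most [d] or [e], forces equality in
   both. *)
have := subset_leq_card sL12; rewrite cardsX oL => le12.
have le1 := dvdn_leq d_gt0 d1; have le2 := dvdn_leq e_gt0 d2.
have o1 : #|P1| = d.
  apply/eqP; rewrite eqn_leq le1 -(@leq_pmul2r e) //.
  by rewrite (leq_trans le12) // leq_mul2l le2 orbT.
have o2 : #|P2| = e.
  by apply/eqP; rewrite eqn_leq le2 -(@leq_pmul2l d) //= -{2}o1.
exists (P1, P2); first by rewrite !inE /= sP1 sP2 o1 o2 !eqxx.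
apply/val_inj/eqP; rewrite eqEcard sL12 /= cardsX oL.
by rewrite leq_mul.
Qed.

End GroupLemmas.

(** * A permutation model of the dicyclic group *)

Section DicyclicModel.

Local Open Scope ring_scope.

Variable n : nat.
Hypothesis n_gt0 : (0 < n)%N.

Let M := (2 * n)%N.
(** The type ['Z_M] is the ring of integers modulo [M] only when [M > 1]. *)
Let M_gt1 : (1 < M)%N. Proof. by rewrite /M -(ltn_predK n_gt0) mulnS. Qed.

(* The pair (e, i) stands for a^i b^e, on which a and b act on the right. *)
Let X := (bool * 'Z_M)%type.
Let fa (u : X) : X := (u.1, if u.1 then u.2 - 1 else u.2 + 1).
Let fb (u : X) : X := (~~ u.1, if u.1 then u.2 + n%:R else u.2).

Let M0 : M%:R = 0 :> 'Z_M. Proof. exact: pchar_Zp. Qed.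
Let n2 : n%:R + n%:R = 0 :> 'Z_M.
Proof. by rewrite -GRing.natrD addnn -mul2n M0. Qed.

Let fa_inj : injective fa.
Proof.
move=> [e i] [e' i'] eqf; have eqe : e = e' := congr1 fst eqf.
have := congr1 snd eqf; rewrite {}eqe /fa ![in _.1]/fst ![in _.2]/snd.
by case: e' {eqf} => /GRing.addIr->.
Qed.

Let fb_inj : injective fb.
Proof.
move=> [e i] [e' i'] eqf; have eqe : e = e' := negb_inj (congr1 fst eqf).
have := congr1 snd eqf; rewrite {}eqe /fb ![in _.1]/fst ![in _.2]/snd.
by case: e' {eqf} => [/GRing.addIr-> | ->].
Qed.

Let a := perm fa_inj.
Let b := perm fb_inj.

Let aXE (k : nat) e i : (a ^+ k)%g (e, i) = (e, if e then i - k%:R else i + k%:R).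
Proof.
elim: k => [|k IHk]; first by rewrite perm1 GRing.subr0 GRing.addr0 if_same.
rewrite expgSr permM IHk permE /fa /=; case: e {IHk}.
  by rewrite -GRing.natr1 GRing.opprD GRing.addrA.
by rewrite -GRing.natr1 GRing.addrA.
Qed.

Let bE e i : b (e, i) = (~~ e, if e then i + n%:R else i).
Proof. by rewrite permE. Qed.

(** The relations by themselves only bound the order from above by [4 * n]; a concrete realisation
    shows that they cause no further collapse. *)
Lemma dicyclic_model :
  exists (rT : finGroupType) (x y : rT),
    [/\ (x ^+ (2 * n)%N = 1)%g, (x ^+ n = y ^+ 2)%g, (y * x * y^-1 = x^-1)%g
      & (4 * n <= #|(<[x]> <*> <[y]>)%g|)%N].
Proof.
exists _, a, b; split.
- apply/permP=> -[e i]; rewrite aXE perm1 M0 GRing.subr0 GRing.addr0.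
  by rewrite if_same.
- apply/permP=> -[e i]; rewrite aXE permM !bE negbK.
  case: e => //=; congr (_, _).
  (* When [e] is true, [a ^+ n] subtracts [n] while [b ^+ 2] adds it; these agree modulo [2 * n]. *)
  by apply/eqP; rewrite GRing.subr_eq -GRing.addrA n2 GRing.addr0.
- apply: (canLR (mulgK b)); apply: (canRL (mulKg a)).
  apply/permP=> -[e i]; rewrite !permM -[a]expg1 !aXE !bE.
  case: e => /=; rewrite ?aXE /=; congr (_, _).
    by rewrite GRing.addrAC GRing.subrK.
  by rewrite GRing.addrK.
(* The element [f u] sends the base point [(false, 0)] to [u], so the [4 * n] elements [f u] are
   distinct. *)
pose f (u : X) := (a ^+ (u.2 : nat) * b ^+ u.1)%g.
have f0 u : f u (false, 0) = u.
  case: u => e i; rewrite /f permM aXE GRing.add0r natr_Zp /=.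
  by case: e; rewrite ?expg1 ?bE ?perm1.
have f_inj : injective f by move=> u v eqf; rewrite -(f0 u) eqf f0.
have -> : (4 * n)%N = #|f @: [set: X]|.
  rewrite card_imset // cardsT card_prod card_bool card_ord Zp_cast //.
  by rewrite /M mulnA.
apply/subset_leq_card/subsetP=> _ /imsetP[u _ ->].
apply: groupM; apply: groupX; first exact: (subsetP (joing_subl _ _)) (cycle_id _).
exact: (subsetP (joing_subr _ _)) (cycle_id _).
Qed.

End DicyclicModel.

(** * Structure and subgroups of the dicyclic group *)

Section DicyclicSubgroups.

Local Open Scope group_scope.

Lemma dicyclic_structure (gT : finGroupType) (T : {group gT}) (n : nat) :
  0 < n -> dicyclic n T ->
  exists a : gT, [/\ a \in T, #[a] = (2 * n)%N, #|T : <[a]>| = 2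
    & forall x, x \in T :\: <[a]> -> x ^+ 2 = a ^+ n].
Proof.
move=> n_gt0 isoT.
have [rT [x [y [xM xy2 yxy leH]]]] := dicyclic_model n n_gt0.
(* The model satisfies the relations, hence is a homomorphic image of [T]; this gives
   [4 * n <= #|T|]. *)
have homH : <[x]> <*> <[y]> \homg T.
  rewrite isoT; apply/existsP; exists (x, y).
  by rewrite /= !xpair_eqE xM xy2 yxy !eqxx.
have leT : 4 * n <= #|T| := leq_trans leH (dvdn_leq (cardG_gt0 T) (card_homg homH)).
have /existsP[[a b]] := isoGrp_hom isoT.
rewrite /= !xpair_eqE => /andP[/eqP defT /and3P[/eqP aM /eqP ab2 /eqP bab]].
have nab : b \in 'N(<[a]>).
  (* The relation says that conjugation by [b^-1], in the convention of [^], inverts [a]; hence the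
     passage to [b^-1]. *)
  rewrite -groupV -cycle_subG norms_cycle /conjg invgK mulgA bab.
  by rewrite groupV cycle_id.
have b2A : b ^+ 2 \in <[a]> by rewrite -ab2 mem_cycle.
have leTa : #|T| <= (2 * #[a])%N by rewrite -defT card_join_sqr_leq.
have oa : #[a] = (2 * n)%N.
  apply/eqP; rewrite eqn_leq dvdn_leq ?muln_gt0 ?order_dvdn ?aM //=.
  by rewrite -(@leq_pmul2l 2) // mulnA (leq_trans leT).
have sAT : <[a]> \subset T by rewrite -defT joing_subl.
have oT : #|T| = (2 * #[a])%N.
  by apply/eqP; rewrite eqn_leq leTa oa mulnA.
have iAT : #|T : <[a]>| = 2 by rewrite -divgS // oT mulnK ?order_gt0.
have bT : b \in T by rewrite -defT (subsetP (joing_subr _ _)) ?cycle_id.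
have bA : b \notin <[a]>.
  apply: contra_eqN iAT => Ab.
  by rewrite -defT (joing_idPl _) ?cycle_subG // indexgg.
exists a; split=> // [|z]; first by rewrite -cycle_subG.
(* The complement of [<[a]>] is the coset of [b], so [z = a ^+ i * b]; moving [b] past [a ^+ i]
   inverts that power, and [z ^+ 2 = b ^+ 2]. *)
rewrite -(rcoset_index2 sAT iAT (x := b)) ?inE ?bA ?bT //.
case/rcosetP=> _ /cycleP[i ->] ->.
have bai : b * a ^+ i = a ^- i * b.
  apply: (canRL (mulgKV b)).
  by have := conjXg a b^-1 i; rewrite /conjg invgK !mulgA bab expgVn.
by rewrite expgS expg1 -mulgA (mulgA b) bai !mulgA mulgV mul1g ab2 expgS expg1.
Qed.

Lemma num_subgroups_not_sub (gT : finGroupType) (T : {group gT}) (a : gT)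
    (n d : nat) :
  a \in T -> #[a] = (2 * n)%N -> #|T : <[a]>| = 2 ->
  (forall x, x \in T :\: <[a]> -> x ^+ 2 = a ^+ n) ->
  #|[set H in subgroups T | (#|H| == d) && ~~ (H \subset <[a]>)]|
    = if (4 %| d) && (d %| 4 * n) then (4 * n) %/ d else 0.
Proof.
move=> Ta oa iAT sqT; set S := [set H in _ | _].
have sAT : <[a]> \subset T by rewrite cycle_subG.
have n_gt0 : 0 < n by have := order_gt0 a; rewrite oa; case: n {oa sqT}.
have oan : #[a ^+ n] = 2 by rewrite orderXdiv oa ?dvdn_mull // mulnK.
have nAT : T \subset 'N(<[a]>) by case/andP: (index2_normal sAT iAT).
have inS (H : {group gT}) : H \in S ->
    [/\ H \subset T, #|H| = d, #|H| = (2 * #|H :&: <[a]>|)%N & a ^+ n \in H].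
  rewrite !inE => /and3P[sHT /eqP oH nHA]; split=> //.
    exact: card_setI_index2 sAT iAT sHT nHA.
  case/subsetPn: nHA => x Hx Ax.
  by rewrite -(sqT x) ?inE ?Ax ?(subsetP sHT) // groupX.
case: ifPn => [/andP[d4 d4n] | nd]; last first.
  (* For [H] in [S], the order [d / 2] of [H :&: <[a]>] is even because of the involution [a ^+ n],
     and divides [2 * n]. *)
  apply/eqP; rewrite cards_eq0; apply: contraR nd => /set0Pn[H /inS[sHT oH oHA Hz]].
  have Kz : <[a ^+ n]> \subset H :&: <[a]> by rewrite cycle_subG inE Hz mem_cycle.
  rewrite -oH {1}oHA -[4]/(2 * 2)%N dvdn_pmul2l //= -{1}oan cardSg //=.
  by rewrite oHA -mulnA dvdn_pmul2l // -oa orderE cardSg ?subsetIr.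
have d_gt0 : 0 < d by apply: dvdn_gt0 d4n; rewrite muln_gt0.
have [h dh] : exists h, d = (2 * (2 * h))%N.
  by case/dvdnP: d4 => h ->; exists h; rewrite mulnA mulnC.
have hdvd : (2 * h %| #[a])%N by rewrite oa -(@dvdn_pmul2l 2) // -dh mulnA.
have [K defK] : exists K : {group gT},
    [set H : {group gT} | H \subset <[a]> & #|H| == (2 * h)%N] = [set K].
  by eexists; apply: cycle_sub_group.
have [sKA oK] : K \subset <[a]> /\ #|K| = (2 * h)%N.
  by have := set11 K; rewrite -defK inE => /andP[? /eqP].
have sub_uniq (H : {group gT}) :
    H \subset <[a]> -> #|H| = (2 * h)%N -> H = K.
  by move=> sHA oH; apply/set1P; rewrite -defK inE sHA oH eqxx.
(* Inside a cyclic group, inclusion of subgroups amounts to divisibility of their orders, here 2 and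
   [2 * h]. *)
have Kz : a ^+ n \in K.
  rewrite -cycle_subG -(cardSg_cyclic (cycle_cyclic a)) ?cycle_subG ?mem_cycle //.
  by rewrite -orderE oan oK dvdn_mulr.
have HA (H : {group gT}) : H \in S -> (H :&: <[a]>)%G = K.
  move=> /inS[_ oH oHA _]; apply: sub_uniq; first exact: subsetIr.
  by apply/eqP; rewrite -(@eqn_pmul2l 2) // -oHA oH dh.
have joinS x : x \in T :\: <[a]> -> (K <*> <[x]>)%G \in S.
  move=> TAx; have [Tx A'x] : x \in T /\ x \notin <[a]>.
    by move: TAx; rewrite inE => /andP[].
  rewrite !inE join_subG (subset_trans sKA) // cycle_subG Tx /=.
  apply/andP; split.
    rewrite card_join_sqr ?oK ?dh //.
    - have /andP[_ nKT] : K <| T.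
        rewrite (char_normal_trans _ (index2_normal sAT iAT)) //.
        by rewrite sub_cyclic_char ?cycle_cyclic.
      exact: (subsetP nKT).
    - by rewrite sqT.
    - by apply: contra A'x; apply: (subsetP sKA).
  apply: contra A'x => /(subset_trans (joing_subr _ _)).
  by rewrite cycle_subG.
(* Double counting of the pairs (H, x) with x in H outside <a>. *)
have count : (#|S| * (2 * h) = #|T :\: <[a]>|)%N.
  transitivity (\sum_(H in S) \sum_(x in T :\: <[a]> | x \in H) 1)%N.
    rewrite -sum_nat_const; apply: eq_bigr => H SH.
    have [sHT oH oHA _] := inS H SH.
    rewrite sum1_card; transitivity #|H :\: <[a]>|.
      rewrite cardsD -[H :&: _]/(gval (H :&: <[a]>)%G) HA // oH oK dh.
      by rewrite [(2 * (2 * h))%N]mul2n -addnn addnK.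
    apply: eq_card => x; rewrite inE [in RHS]unfold_in inE.
    by case Hx: (x \in H); rewrite ?andbF // (subsetP sHT _ Hx) !andbT.
  rewrite (exchange_big_dep (mem (T :\: <[a]>))) //=; last by move=> H x _ /andP[].
  rewrite -sum1_card; apply: eq_bigr => x TAx.
  (* Exactly one [H] in [S] contains [x]: it includes [K <*> <[x]>], which has the same order
     [d]. *)
  rewrite (eq_bigl (pred1 (K <*> <[x]>)%G)) ?big_pred1_eq // => H /=.
  rewrite TAx /=; apply/andP/eqP=> [[SH Hx] | ->]; last first.
    by split; [exact: joinS | rewrite -cycle_subG joing_subr].
  have [_ oH _ _] := inS H SH.
  have [_ oJ _ _] := inS _ (joinS x TAx).
  have sKH : K \subset H by rewrite -(HA H SH) subsetIl.
  apply/esym/val_inj/eqP; rewrite eqEcard oH oJ leqnn andbT.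
  by rewrite join_subG sKH cycle_subG.
have oTA : #|T :\: <[a]>| = (2 * n)%N.
  rewrite cardsD (setIidPr sAT) -(Lagrange sAT) iAT -orderE oa.
  by rewrite muln2 -addnn addnK.
by apply/eqP; rewrite eqn_div // dh mulnCA count oTA mulnA.
Qed.

Lemma num_subgroups_dicyclic (gT : finGroupType) (T : {group gT}) (n d : nat) :
  0 < n -> dicyclic n T ->
  num_subgroups T d
    = ((d %| 2 * n) + if (4 %| d) && (d %| 4 * n) then (4 * n) %/ d else 0)%N.
Proof.
move=> n_gt0 /(dicyclic_structure _ _ _ n_gt0)[a [Ta oa iAT sqT]].
rewrite -(num_subgroups_not_sub _ _ _ _ _ Ta oa iAT sqT) -oa orderE.
rewrite -num_subgroups_cyclic ?cycle_cyclic // /num_subgroups.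
rewrite -(cardsID [set H : {group gT} | H \subset <[a]>]).
congr (_ + _)%N; apply: eq_card => H; rewrite !inE; last by rewrite andbC andbA.
have [sHA | _] := boolP (H \subset <[a]>); rewrite ?andbF ?andbT //.
by rewrite (subset_trans sHA) ?cycle_subG.
Qed.

Lemma card_dicyclic (gT : finGroupType) (T : {group gT}) (n : nat) :
  0 < n -> dicyclic n T -> #|T| = (4 * n)%N.
Proof.
move=> n_gt0 /(dicyclic_structure _ _ _ n_gt0)[a [Ta oa iAT _]].
have sAT : <[a]> \subset T by rewrite cycle_subG.
by rewrite -(Lagrange sAT) iAT -orderE oa muln2 -mul2n mulnA.
Qed.

End DicyclicSubgroups.

(** * Divisor arithmetic and the final count *)

Lemma sum_divn_divisors (m : nat) :
  0 < m -> \sum_(d <- divisors m) m %/ d = sigma m.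
Proof.
move=> m_gt0; have codiv d : d %| m -> m %/ (m %/ d) = d.
  by move=> dv; rewrite divnA ?mulKn.
rewrite /sigma -(big_map (fun d => m %/ d) predT (fun d => d)).
apply/perm_big/uniq_perm; rewrite ?divisors_uniq //.
  rewrite map_inj_in_uniq ?divisors_uniq // => d e.
  by rewrite -!dvdn_divisors // => /codiv {2}<- /codiv {2}<- ->.
move=> d; rewrite -dvdn_divisors //; apply/mapP/idP => [[e] | dv].
  by rewrite -dvdn_divisors // => dv ->; apply: dvdn_div.
by exists (m %/ d); rewrite ?codiv // -dvdn_divisors // dvdn_div.
Qed.

Lemma dvdn_exp2_mul_odd (s t m l : nat) :
  odd m -> l %| m -> (2 ^ s * l %| 2 ^ t * m) = (s <= t).
Proof.
move=> m_odd lm; apply/idP/idP => [dv | lest]; last first.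
  by rewrite dvdn_mul ?dvdn_exp2l.
rewrite -(@dvdn_Pexp2l 2) // -(@Gauss_dvdl _ _ m) ?(dvdn_trans (dvdn_mulr _ _) dv) //.
by rewrite coprimeXl // coprime2n.
Qed.

(** The two truth values, read as 0 or 1, merge the three cases. The first term counts the subgroups
    of [T] inside the cyclic subgroup of index 2 and vanishes only at [k = r + 3]; the second counts
    the others and vanishes for [k <= 2]. *)
Lemma num_subgroups_dicyclic_mul_cyclic (r m p l eps k : nat)
    (gT hT : finGroupType) (T : {group gT}) (C : {group hT}) :
  odd m -> dicyclic (2 ^ r * m) T -> cyclic C -> #|C| = p ->
  prime p -> odd p -> ~~ (p %| 2 ^ r * m) ->
  l %| m -> eps \in [:: 0; 1] -> 1 <= k <= r + 3 ->
  num_subgroups (setX_group T C) (2 ^ (k - 1) * l * p ^ eps)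
    = (k <= r + 2) + (2 < k) * (2 ^ (r + 3 - k) * (m %/ l)).
Proof.
move=> m_odd dicT cycC oC p_pr p_odd pn lm eps01 /andP[k_gt0 lek].
have n_gt0 : 0 < 2 ^ r * m by rewrite muln_gt0 expn_gt0 (odd_gt0 m_odd).
have oT := card_dicyclic _ _ _ n_gt0 dicT.
have E4n : 4 * (2 ^ r * m) = 2 ^ (r + 2) * m by rewrite addnC expnD -mulnA.
have E2n : 2 * (2 ^ r * m) = 2 ^ (r + 1) * m by rewrite addnC expnD -mulnA.
have dn : 2 ^ (k - 1) * l %| 2 ^ (r + 2) * m.
  by rewrite dvdn_exp2_mul_odd // leq_subLR addnCA.
(* Hence [C] contributes a factor 1 for both values of [eps]. *)
have ep : p ^ eps %| p.
  by move: eps01; rewrite !inE => /orP[] /eqP-> //; rewrite dvd1n.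
rewrite num_subgroups_setX ?oT ?oC ?E4n //; last first.
  rewrite -E4n coprime_sym prime_coprime // Euclid_dvdM // negb_or pn andbT.
  by rewrite -[4]/(2 ^ 2) Euclid_dvdX // andbT dvdn_prime2 //; apply: contraTN p_odd => /eqP->.
rewrite [num_subgroups C _]num_subgroups_cyclic // oC ep muln1.
rewrite (num_subgroups_dicyclic _ _ _ _ n_gt0 dicT) E2n E4n dn andbT.
rewrite dvdn_exp2_mul_odd //; congr (nat_of_bool _ + _).
  by rewrite leq_subLR addnCA.
have -> : 4 %| 2 ^ (k - 1) * l = (2 < k).
  rewrite -[4]/(2 ^ 2) -[2 ^ 2]muln1 dvdn_exp2_mul_odd ?dvd1n //.
    by rewrite ltn_subRL.
  exact: dvdn_odd lm m_odd.
case: ifP => [k_gt2|]; rewrite ?mul0n // mul1n.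
(* Splitting the exponent lets [2 ^ (k - 1)] cancel in the quotient of [4 * n] by
   [2 ^ (k - 1) * l]. *)
have -> : r + 2 = (k - 1) + (r + 3 - k).
  by case: k k_gt0 lek {dn k_gt2} => // s _; rewrite addnS ltnS !subSS subn0 => /subnKC->.
by rewrite expnD -mulnA divnMl ?expn_gt0 // muln_divA.
Qed.

Theorem theorem3p1
  (n r m j : nat) (q zeta : 'I_j -> nat)
  (n_def : n = 2 ^ r * m)
  (m_def : m = \prod_(i < j) q i ^ zeta i)
  (q_inj : injective q)
  (q_prime : forall i : 'I_j, prime (q i))
  (q_odd : forall i : 'I_j, odd (q i))
  (zeta_ge1 : forall i : 'I_j, 1 <= zeta i)
  (j_gt1 : 1 < j)
  (p : nat) (p_prime : prime p) (p_odd : odd p) (p_ndvd : ~~ (p %| n))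
  (gT hT : finGroupType) (T : {group gT}) (C : {group hT})
  (T_dicyclic : dicyclic n T)
  (C_cyclic : cyclic C) (C_card : #|C| = p) :
  let Phi := setX_group T C in
  let N (k lambda eps : nat) :=
    num_subgroups Phi (2 ^ (k - 1) * lambda * p ^ eps) in
  (forall lambda eps k : nat,
      lambda %| m -> eps \in [:: 0; 1] -> 1 <= k <= r + 3 ->
      [/\ k \in [:: 1; 2] -> N k lambda eps = 1,
          3 <= k <= r + 2 -> N k lambda eps = n %/ (2 ^ (k - 3) * lambda) + 1
        & k = r + 3 -> N k lambda eps = n %/ (2 ^ r * lambda)])
  /\
  (forall eps k : nat,
      eps \in [:: 0; 1] -> 1 <= k <= r + 3 ->
      [/\ k \in [:: 1; 2] ->
            \sum_(lambda <- divisors m) N k lambda eps = tau m,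
          3 <= k <= r + 2 ->
            \sum_(lambda <- divisors m) N k lambda eps
              = 2 ^ (r + 3 - k) * sigma m + tau m
        & k = r + 3 ->
            \sum_(lambda <- divisors m) N k lambda eps = sigma m]).
Proof.
move=> Phi N.
have m_odd : odd m.
  rewrite m_def; elim/big_ind: _ => // [x y ? ? | i _]; rewrite ?oddM ?oddX.
    by apply/andP.
  by rewrite q_odd orbT.
have m_gt0 := odd_gt0 m_odd.
subst n.
have NE l eps k : l %| m -> eps \in [:: 0; 1] -> 1 <= k <= r + 3 ->
    N k l eps = (k <= r + 2) + (2 < k) * (2 ^ (r + 3 - k) * (m %/ l)).
  exact: num_subgroups_dicyclic_mul_cyclic.
split=> [l eps k lm eps01 kr | eps k eps01 kr].
  rewrite NE //; split=> [k12 | /andP[k_gt2 kr2] | ->].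
  (* With [2 + r] in place of [r + 2], both comparisons compute for the numerals 1 and 2. *)
  - by rewrite !inE in k12; case/orP: k12 => /eqP->; rewrite [r + 2]addnC.
  - rewrite k_gt2 kr2 mul1n addnC; congr (_ + _).
    have -> : 2 ^ r = 2 ^ (k - 3) * 2 ^ (r + 3 - k).
      rewrite -expnD; congr (_ ^ _).
      by case/andP: kr => _ ?; rewrite addnBA // addnCA subnK // addnK.
    by rewrite -mulnA divnMl ?expn_gt0 // muln_divA.
  - by rewrite subnn divnMl ?expn_gt0 // leq_add2l ltn_addl // !mul1n.
have -> : \sum_(l <- divisors m) N k l eps
    = (k <= r + 2) * tau m + (2 < k) * (2 ^ (r + 3 - k) * sigma m).
  (* The constant term sums to the number of divisors, and the quotients [m %/ l] run over all
     divisors of [m]. *)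
  rewrite -sum_divn_divisors // !big_distrr /= /tau -sum1_size big_distrr -big_split.
  rewrite big_seq [RHS]big_seq; apply: eq_bigr => l.
  by rewrite -dvdn_divisors // => lm; rewrite NE //= muln1.
split=> [k12 | /andP[k_gt2 kr2] | ->].
- by rewrite !inE in k12; case/orP: k12 => /eqP->;
    rewrite [r + 2]addnC -[LHS]/(1 * tau m + 0) mul1n addn0.
- by rewrite k_gt2 kr2 !mul1n addnC.
- by rewrite subnn leq_add2l ltn_addl // !mul1n.
Qed.
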